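(* For every $k\ge3$, $$q(\mathcal{V}_{m_k})>1 .$$ Moreover, $$\Delta_{m_k}\ \ge\ \log m_k-\log\log_2(2m_k)$$ and, for every $k\ge4$, $$q(\mathcal{V}_{m_k})\ \ge\ 1+\frac{\log m_k-\log\log_2(2m_k)-\log2}{(m_k+1)\log2}.$$ In particular, $$q(\mathcal{V}_{m_k})-1\ \ge\ \bigl(1-o(1)\bigr)\,\frac{\log m_k}{m_k\log2}$$ as $k\to\infty$, and therefore as $m_k\to\infty$, the exponents $m_k=\mathrm{lcm}(1,\dots,k)$ being strictly increasing in $k$.
   Context: For $k\ge1$, $m_k=\mathrm{lcm}(1,2,\dots,k)$. For $m\ge2$, $\mathcal{V}_m=(1,2^m-1,2^m)$. For a triple $(a,b,c)$ of pairwise coprime positive integers with $a+b=c$, the quality is $q(a,b,c)=\log c/\log\mathrm{rad}(abc)$, where $\mathrm{rad}(n)$ is the product of the distinct primes dividing $n$. For $m\ge2$, $\Delta_m=\log\bigl((2^m-1)/\mathrm{rad}(2^m-1)\bigr)$. $\log$ is the natural logarithm and $\log_2$ the logarithm to base $2$; $\log\log_2(x)$ means $\log(\log_2 x)$.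
   Formalization: The claim that the exponents m_k are strictly increasing in k is false (m_5 = m_6 = 60); it is replaced by the statements that m_k is non-decreasing in k and that m_k tends to infinity as k tends to infinity. *)

(* Defs.v *)
From mathcomp Require Import all_boot all_order all_algebra.
From mathcomp Require Import all_classical all_reals all_analysis.

Set Implicit Arguments.
Unset Strict Implicit.
Unset Printing Implicit Defensive.

Import Order.TTheory GRing.Theory Num.Theory.

Local Open Scope ring_scope.

Definition lcm_upto (k : nat) : nat := (\big[lcmn/1]_(1 <= i < k.+1) i)%N.

Definition rad (n : nat) : nat := (\prod_(p <- primes n) p)%N.

Definition is_abc_triple (t : nat * nat * nat) : Prop :=
  let: (a, b, c) := t in
  [/\ (0 < a)%N, (0 < b)%N & (0 < c)%N] /\
  [/\ coprime a b, coprime a c & coprime b c] /\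
  (a + b = c)%N.

(* [quality] is total, but only meaningful on triples satisfying
   [is_abc_triple]. *)
Definition quality (R : realType) (t : nat * nat * nat) : R :=
  let: (a, b, c) := t in ln c%:R / ln (rad (a * b * c))%:R.

Definition Vtriple (m : nat) : nat * nat * nat := (1, 2 ^ m - 1, 2 ^ m)%N.

Lemma Vtriple_abc (m : nat) : (2 <= m)%N -> is_abc_triple (Vtriple m).
Proof.
move=> m2; have m0 : (0 < m)%N by apply: leq_trans m2.
have p1 : (1 < 2 ^ m)%N by rewrite -{1}(expn0 2) ltn_exp2l.
have p0 : (0 < 2 ^ m)%N by apply: ltnW.
split; first by split; rewrite // subn_gt0.
split; last by rewrite subnKC.
split; rewrite ?coprime1n //.
by rewrite subn1 coprime_sym coprimenP.
Qed.

Definition log2 (R : realType) (x : R) : R := ln x / ln 2.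

Definition Delta (R : realType) (m : nat) : R :=
  ln ((2 ^ m - 1)%N%:R / (rad (2 ^ m - 1))%:R).

(* Main.v *)
Require Import Defs.
From mathcomp Require Import all_boot all_order all_algebra.
From mathcomp Require Import all_classical all_reals all_analysis.
From mathcomp Require Import cyclic zify ring lra.

(** Write m = lcm(1, ..., k) and N = 2 ^ m - 1.  The radical of the product of
the triple is 2 rad(N), so its quality exceeds 1 as soon as N / rad(N) is at
least 2, and the excess is governed by Delta_m = ln (N / rad(N)).  The exponent m
is chosen to make N / rad(N) large: if an odd prime p divides m, then p <= k, so
p - 1 also divides m.  Hence (p - 1) p ^ e, the totient of p ^ (e + 1), divides m
for e the exponent of p in m, and Euler's theorem gives p ^ (e + 1) | N.  One
factor p is absorbed by rad(N), and p ^ e is left over.  Altogether the odd part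
of m divides N / rad(N) ([lcm_upto_odd_part_dvd_mersenne]).

Only the 2-part q of m is lost.  It is a power of 2 that is at most k, while
lcm(1, ..., k) >= 2 ^ (k - 1) ([lcm_upto_ge_exp2], read off Leibniz's harmonic
triangle).  So 2 ^ q <= 2 m, that is q <= log2 (2 m), and
Delta_m >= ln (m / q) >= ln m - ln (log2 (2 m)) ([Delta_lcm_upto_ge]).

The quality is m ln 2 / D with D = ln 2 + ln N - Delta_m.  Its numerator exceeds D
by at least Delta_m - ln 2, which is positive when k >= 3 because the odd part of
m is then at least 3, and D <= (m + 1) ln 2 ([quality_ge_Delta]).  This gives both
the strict bound and the quantitative one.  For the asymptotic form,
ln (log2 (2 m)) = O(sqrt (ln m)), so the relative error is at most
C / sqrt (ln m) + 1 / (m + 1) for a constant C ([main_term_ge]).  This is a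
function of m alone, so it serves for the limit in m and, composed with
k |-> lcm(1, ..., k), for the limit in k. *)

Set Implicit Arguments.
Unset Strict Implicit.
Unset Printing Implicit Defensive.

Import Order.TTheory GRing.Theory Num.Theory.
Import numFieldNormedType.Exports.

Local Open Scope nat_scope.

(** * The least common multiple of 1, ..., k *)

Lemma lcm_uptoS k : lcm_upto k.+1 = lcmn (lcm_upto k) k.+1.
Proof. by rewrite /lcm_upto big_nat_recr. Qed.

Lemma lcm_upto_gt0 k : 0 < lcm_upto k.
Proof.
elim: k => [|k IHk]; first by rewrite /lcm_upto big_nil.
by rewrite lcm_uptoS lcmn_gt0 IHk.
Qed.

Lemma dvdn_lcm_upto_mono k l : k <= l -> lcm_upto k %| lcm_upto l.
Proof.
elim: l => [|l IHl]; first by rewrite leqn0 => /eqP->.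
rewrite leq_eqVlt => /orP[/eqP-> //|/IHl kl].
by rewrite lcm_uptoS (dvdn_trans kl) ?dvdn_lcml.
Qed.

Lemma dvdn_lcm_upto i k : 0 < i -> i <= k -> i %| lcm_upto k.
Proof.
case: i => // i _ ik; apply: dvdn_trans (dvdn_lcm_upto_mono ik).
by rewrite lcm_uptoS dvdn_lcmr.
Qed.

Lemma lcm_upto_leq k l : k <= l -> lcm_upto k <= lcm_upto l.
Proof. by move=> kl; rewrite dvdn_leq ?lcm_upto_gt0 ?dvdn_lcm_upto_mono. Qed.

Lemma leq_lcm_upto k : k <= lcm_upto k.
Proof.
by case: k => // k; rewrite dvdn_leq ?lcm_upto_gt0 ?dvdn_lcm_upto.
Qed.

(** The p-part of an lcm is the largest of the p-parts of its arguments. *)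
Lemma lcm_upto_part p k : prime p -> 0 < k -> (lcm_upto k)`_p <= k.
Proof.
move=> p_pr; rewrite p_part; elim: k => // -[_ _|k /(_ isT) IHk _].
  by rewrite /lcm_upto big_nat1 /= logn1 expn0.
rewrite lcm_uptoS logn_lcm ?lcm_upto_gt0 // /maxn; case: ifP => _.
  by rewrite dvdn_leq // pfactor_dvdnn.
exact: leq_trans IHk _.
Qed.

(** The numbers (n + 1) 'C(n, j) are the denominators of Leibniz's harmonic
triangle, whose entries satisfy
1 / ((n + 2) 'C(n+1, j+1)) = 1 / ((n + 1) 'C(n, j)) - 1 / ((n + 2) 'C(n+1, j)).
If D is a common multiple of the two denominators on the right, then D times the
left-hand side is an integer. *)
Lemma leibniz_dvdn_lcm n j : j <= n -> n.+1 * 'C(n, j) %| lcm_upto n.+1.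
Proof.
elim: j n => [n _|j IHj [//|n]]; first by rewrite bin0 muln1 dvdn_lcm_upto.
rewrite ltnS => jn.
have /dvdnP[y Dy] := IHj n.+1 (leqW jn).
have /dvdnP[x Dx] := dvdn_trans (IHj n jn) (dvdn_lcm_upto_mono (leqnSn n.+1)).
set D := lcm_upto _ in Dx Dy *.
have E1 := mul_bin_diag n.+1 j; have E2 := mul_bin_down n.+1 j.
rewrite /= in E1 E2.
have c0 : 0 < n.+1 * 'C(n, j) by rewrite muln_gt0 bin_gt0.
(* [x] and [y] are the quotients of [D] by the two known denominators; this
   relation is their ratio, and it makes [x - y] the quotient by the third. *)
have y0 : n.+2 * y = (n.+1 - j) * x.
  apply/eqP; rewrite -(eqn_pmul2r c0); apply/eqP.
  by rewrite -[RHS]mulnA -Dx Dy E2; lia.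
apply/dvdnP; exists (x - y).
apply/eqP; rewrite -(eqn_pmul2l (ltn0Sn j)); apply/eqP.
have -> : j.+1 * ((x - y) * (n.+2 * 'C(n.+1, j.+1)))
    = n.+2 * (x - y) * (j.+1 * 'C(n.+1, j.+1)) by lia.
rewrite -E1 mulnBr y0 Dx mulnA; congr (_ * _); nia.
Qed.

(** Summing the n + 1 denominators in row n of the harmonic triangle, with
n = k - 1, gives (n + 1) 2 ^ n; each of them is at most the lcm. *)
Lemma lcm_upto_ge_exp2 k : 0 < k -> 2 ^ k.-1 <= lcm_upto k.
Proof.
case: k => // n _; rewrite -(leq_pmul2l (ltn0Sn n)) /=.
rewrite -[2]/(1 + 1) expnDn big_distrr /=.
rewrite -[X in _ <= X * _](card_ord n.+1) -sum_nat_const.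
apply: leq_sum => j _; rewrite !exp1n !muln1.
by rewrite dvdn_leq ?lcm_upto_gt0 ?leibniz_dvdn_lcm // -ltnS.
Qed.

(** * Radicals *)

Lemma rad_gt0 n : 0 < Defs.rad n.
Proof.
rewrite /Defs.rad big_seq prodn_cond_gt0 // => p.
by rewrite mem_primes => /andP[/prime_gt0].
Qed.

Lemma rad_coprimeM a b : 0 < a -> 0 < b -> coprime a b ->
  Defs.rad (a * b) = Defs.rad a * Defs.rad b.
Proof.
move=> a0 b0 ab; rewrite /Defs.rad -big_cat /=; apply: perm_big.
apply: uniq_perm; first exact: primes_uniq.
  by rewrite cat_uniq !primes_uniq andbT /= -coprime_has_primes.
by move=> p; rewrite mem_cat primesM.
Qed.

Lemma logn_rad p n : logn p (Defs.rad n) = (p \in primes n).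
Proof.
rewrite -count_uniq_mem ?primes_uniq // /Defs.rad.
have : all prime (primes n) by apply/allP => q; rewrite mem_primes => /andP[].
elim: (primes n) => [|q s IHs] /=; first by rewrite big_nil logn1.
case/andP=> q_pr s_pr; rewrite big_cons lognM ?IHs ?(prime_gt0 q_pr) ?logn_prime //.
  by rewrite eq_sym.
rewrite big_seq prodn_cond_gt0 // => r rs.
by rewrite prime_gt0 // (allP s_pr).
Qed.

(** At a prime dividing d, the factor rad(n) costs exactly one more power of that
prime; at the other primes it never costs more than n contains. *)
Lemma dvdn_mul_rad d n : 0 < d -> 0 < n ->
  (forall p, prime p -> p %| d -> p ^ (logn p d).+1 %| n) -> d * Defs.rad n %| n.
Proof.
move=> d0 n0 dn; have r0 := rad_gt0 n.
apply/dvdn_partP => [|p]; first by rewrite muln_gt0 d0.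
rewrite mem_primes => /andP[p_pr _].
rewrite p_part lognM // logn_rad mem_primes p_pr n0 /=.
have [pd|] := boolP (p %| d).
  apply: dvdn_trans (dn p p_pr pd); apply: dvdn_exp2l.
  by rewrite -addn1 leq_add2l leq_b1.
move=> pd; rewrite lognE p_pr d0 (negPf pd) /= add0n.
by case: (boolP (p %| n)).
Qed.

(** * Prime powers dividing 2 ^ m - 1 *)

Lemma mersenne_gt0 m : 0 < m -> 0 < 2 ^ m - 1.
Proof. by move=> m0; rewrite subn_gt0 -{1}(expn0 2) ltn_exp2l. Qed.

Lemma dvdn_exp2_sub1 m d N : d %| m -> 2 ^ d = 1 %[mod N] -> N %| 2 ^ m - 1.
Proof.
move=> /dvdnP[e ->] h; rewrite -eqn_mod_dvd ?expn_gt0 //.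
by rewrite mulnC expnM -modnXm h modnXm exp1n.
Qed.

(** The totient of p ^ (e + 1) is (p - 1) p ^ e, a product of two coprime divisors
of m, so Euler's theorem applies. *)
Lemma odd_pfactor_dvd_mersenne p m : prime p -> odd p -> p.-1 %| m ->
  p ^ (logn p m).+1 %| 2 ^ m - 1.
Proof.
move=> p_pr p_odd p1m.
apply: (@dvdn_exp2_sub1 _ (totient (p ^ (logn p m).+1))); last first.
  by apply: Euler_exp_totient; rewrite coprimeXr // coprime2n.
rewrite totient_pfactor // Gauss_dvd ?p1m ?pfactor_dvdnn //.
by rewrite coprimeXr // coprime_sym coprimenP ?prime_gt0.
Qed.

Lemma odd_dvd_mersenne d m : odd d -> 0 < m -> d %| m ->
  (forall p, prime p -> p %| d -> p.-1 %| m) ->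
  d * Defs.rad (2 ^ m - 1) %| 2 ^ m - 1.
Proof.
move=> d_odd m0 dm dp; have d0 := odd_gt0 d_odd.
apply: dvdn_mul_rad; rewrite ?mersenne_gt0 //.
move=> p p_pr pd; have p_odd := dvdn_odd pd d_odd.
apply: dvdn_trans (odd_pfactor_dvd_mersenne p_pr p_odd (dp p p_pr pd)).
by rewrite dvdn_exp2l // ltnS dvdn_leq_log.
Qed.

(** This is why the exponent is taken to be lcm(1, ..., k): a prime dividing it is
at most k, and so its predecessor is one of the numbers 1, ..., k. *)
Lemma pred_prime_dvd_lcm_upto p k : prime p -> p %| lcm_upto k -> p.-1 %| lcm_upto k.
Proof.
move=> p_pr; have [->|k0] := posnP k; first
  by rewrite /lcm_upto big_nil dvdn1 => /eqP p1; rewrite p1 in p_pr.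
move=> pm; apply: dvdn_lcm_upto; first by case: p p_pr {pm} => [|[]].
apply: leq_trans (leq_pred _) _; apply: leq_trans (lcm_upto_part p_pr k0).
rewrite p_part -{1}[p]expn1 leq_exp2l ?prime_gt1 //.
by rewrite logn_gt0 mem_primes p_pr lcm_upto_gt0.
Qed.

Lemma lcm_upto_odd_part_dvd_mersenne k (m := lcm_upto k) :
  m`_2^' * Defs.rad (2 ^ m - 1) %| 2 ^ m - 1.
Proof.
have m0 : 0 < m := lcm_upto_gt0 k.
apply: odd_dvd_mersenne; rewrite ?dvdn_part //.
  by rewrite odd_2'nat part_pnat.
move=> p p_pr pm; apply: pred_prime_dvd_lcm_upto => //.
exact: dvdn_trans pm (dvdn_part _ _).
Qed.

(** The 2-part of lcm(1, ..., k) is at most k, so this follows from the exponential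
lower bound on the lcm; it says that passing from lcm(1, ..., k) to its odd part
loses only a logarithmic factor. *)
Lemma exp2_two_part k : 0 < k ->
  2 ^ (lcm_upto k)`_2 <= 2 * lcm_upto k.
Proof.
move=> k0; apply: (@leq_trans (2 ^ k)).
  by rewrite leq_exp2l // lcm_upto_part.
by rewrite -{1}(prednK k0) expnS leq_pmul2l // lcm_upto_ge_exp2.
Qed.

Lemma lcm_upto_odd_part_ge3 k : 2 < k -> 3 <= (lcm_upto k)`_2^'.
Proof.
move=> k3; rewrite dvdn_leq ?part_gt0 //.
have -> : 3 = 3`_2^' by rewrite part_pnat_id // -odd_2'nat.
by rewrite partn_dvd ?lcm_upto_gt0 ?dvdn_lcm_upto.
Qed.

(** * Quality and Delta *)

Lemma rad_Vtriple m : 0 < m ->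
  Defs.rad (1 * (2 ^ m - 1) * 2 ^ m) = 2 * Defs.rad (2 ^ m - 1).
Proof.
move=> m0; rewrite mul1n mulnC rad_coprimeM ?mersenne_gt0 ?expn_gt0 //.
  by rewrite /Defs.rad primesX // primes_prime // big_seq1.
by rewrite subn1 coprimenP ?expn_gt0.
Qed.

Local Open Scope classical_set_scope.
Local Open Scope ring_scope.

Lemma ln2_gt0 (R : realType) : 0 < ln (2 : R).
Proof. by rewrite ln_gt0 // ltr1n. Qed.

Lemma ln_le_Delta (R : realType) (d m : nat) : (0 < m)%N -> (0 < d)%N ->
  (d * Defs.rad (2 ^ m - 1) %| 2 ^ m - 1)%N -> ln d%:R <= Delta R m.
Proof.
move=> m0 d0 dvd_d; have r0 := rad_gt0 (2 ^ m - 1).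
have N0 := mersenne_gt0 m0.
rewrite /Delta ler_ln ?posrE ?divr_gt0 ?ltr0n //.
by rewrite ler_pdivlMr ?ltr0n // -natrM ler_nat dvdn_leq.
Qed.

Lemma quality_Vtriple (R : realType) (m : nat) : (0 < m)%N ->
  quality R (Vtriple m) =
    m%:R * ln 2 / (ln 2 + ln (2 ^ m - 1)%N%:R - Delta R m).
Proof.
move=> m0; have r0 := rad_gt0 (2 ^ m - 1).
have N0 := mersenne_gt0 m0.
rewrite /quality /Vtriple rad_Vtriple // natrX lnXn // natrM /Delta.
rewrite lnM ?ln_div ?posrE ?ltr0n // mulr_natl; congr (_ / _); ring.
Qed.

(** With D the denominator of the quality, the quality minus 1 is
(m ln 2 - D) / D.  Since N < 2 ^ m, the numerator is at least Delta_m - ln 2, and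
D <= (m + 1) ln 2.  Nonnegativity of Delta_m - ln 2 is what lets D be replaced by
the larger (m + 1) ln 2. *)
Lemma quality_ge_Delta (R : realType) (m : nat) :
  (0 < m)%N -> ln 2 <= Delta R m ->
  1 + (Delta R m - ln 2) / ((m%:R + 1) * ln 2) <= quality R (Vtriple m).
Proof.
move=> m0 Dm; rewrite quality_Vtriple //.
have r0 := rad_gt0 (2 ^ m - 1).
have N0 := mersenne_gt0 m0.
have l2 := ln2_gt0 R.
have lnN : ln (2 ^ m - 1)%N%:R <= m%:R * ln 2 :> R.
  rewrite mulr_natl -lnXn // -natrX ler_ln ?posrE ?ltr0n ?expn_gt0 //.
  by rewrite ler_nat leq_subr.
have lnr : 0 <= ln (Defs.rad (2 ^ m - 1))%:R :> R by rewrite ln_ge0 // ler1n.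
have DE : Delta R m = ln (2 ^ m - 1)%N%:R - ln (Defs.rad (2 ^ m - 1))%:R.
  by rewrite /Delta ln_div ?posrE ?ltr0n.
set D := (X in _ <= _ / X).
have D0 : 0 < D by rewrite /D DE; lra.
have m1 : 0 < m%:R + 1 :> R by rewrite natr1 ltr0n.
have Dle : D <= (m%:R + 1) * ln 2 by rewrite /D DE; lra.
rewrite -lerBrDl; apply: (@le_trans _ _ ((Delta R m - ln 2) / D)).
  rewrite ler_wpM2l ?subr_ge0 // lef_pV2 ?posrE //; exact: mulr_gt0.
rewrite ler_pdivrMr // mulrBl mulfVK ?gt_eqF // mul1r /D; lra.
Qed.

(** * Bounds for a fixed exponent lcm(1, ..., k) *)

(** Delta_m is at least the logarithm of the odd part of m, and the 2-part of m is
at most log2 (2 m). *)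
Lemma Delta_lcm_upto_ge (R : realType) (k : nat) (m := lcm_upto k) : (0 < k)%N ->
  ln m%:R - ln (log2 (2 * m%:R)) <= Delta R m.
Proof.
move=> k0; have m0 : (0 < m)%N := lcm_upto_gt0 k.
apply: le_trans (ln_le_Delta R m0 _ (lcm_upto_odd_part_dvd_mersenne k)); last first.
  exact: part_gt0.
have p2 : (0 < m`_2)%N by exact: part_gt0.
have l2 := ln2_gt0 R.
have log2_ge : (m`_2)%N%:R <= log2 (2 * m%:R) :> R.
  rewrite /log2 ler_pdivlMr // [X in X <= _]mulr_natl -lnXn // -natrX -natrM.
  by rewrite ler_ln ?posrE ?ltr0n ?expn_gt0 ?muln_gt0 // ler_nat exp2_two_part.
have lnm : ln m%:R = ln (m`_2)%N%:R + ln (m`_2^')%N%:R :> R.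
  by rewrite -lnM ?posrE ?ltr0n ?part_gt0 // -natrM partnC.
have p2R : 0 < (m`_2)%N%:R :> R by rewrite ltr0n.
have : ln (m`_2)%N%:R <= ln (log2 (2 * m%:R)) :> R.
  by rewrite ler_ln ?posrE // (lt_le_trans p2R).
lra.
Qed.

Lemma Delta_lcm_upto_gt (R : realType) (k : nat) : (3 <= k)%N ->
  ln 2 < Delta R (lcm_upto k).
Proof.
move=> k3; apply: lt_le_trans
  (ln_le_Delta R (lcm_upto_gt0 k) _ (lcm_upto_odd_part_dvd_mersenne k)).
  by rewrite ltr_ln ?posrE ?ltr0n ?part_gt0 // ltr_nat; exact: lcm_upto_odd_part_ge3.
exact: part_gt0.
Qed.

Lemma quality_lcm_upto_gt1 (R : realType) (k : nat) : (3 <= k)%N ->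
  1 < quality R (Vtriple (lcm_upto k)).
Proof.
move=> k3; have D := Delta_lcm_upto_gt R k3.
apply: lt_le_trans (quality_ge_Delta (lcm_upto_gt0 k) (ltW D)).
by rewrite ltrDl divr_gt0 ?subr_gt0 ?mulr_gt0 ?ln2_gt0 // natr1.
Qed.

Lemma quality_lcm_upto_ge (R : realType) (k : nat) (m := lcm_upto k) : (3 <= k)%N ->
  1 + (ln m%:R - ln (log2 (2 * m%:R)) - ln 2) / ((m%:R + 1) * ln 2)
    <= quality R (Vtriple m).
Proof.
move=> k3.
have D := ltW (Delta_lcm_upto_gt R k3).
apply: le_trans (quality_ge_Delta (lcm_upto_gt0 k) D).
rewrite lerD2l ler_wpM2r ?invr_ge0 ?mulr_ge0 ?(ltW (ln2_gt0 R)) ?natr1 //.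
by rewrite lerB // Delta_lcm_upto_ge // (leq_trans _ k3).
Qed.

(** * The error term *)

Lemma ln_le_sqrt (R : realType) (x : R) : 0 < x -> ln x <= 2 * Num.sqrt x.
Proof.
move=> x0; rewrite -{1}(sqr_sqrtr (ltW x0)) lnXn ?sqrtr_gt0 // mulr_natl.
by rewrite lerMn2r /= ltW // ln_sublinear // sqrtr_gt0.
Qed.

(** Chosen so that, for ln m >= 1, 1 + ln m / ln 2 <= (1 + 1 / ln 2) ln m turns the
square-root bound on ln (log2 (2 m)) into a multiple of sqrt (ln m); the summand
ln 2 pays for the extra ln 2 in the quality bound. *)
Definition error_const (R : realType) : R :=
  2 * Num.sqrt (1 + (ln 2)^-1) + ln 2.

Definition rel_error (R : realType) (m : nat) : R :=
  error_const R / Num.sqrt (ln m%:R) + (m.+1)%:R^-1.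

Lemma log2_double (R : realType) (m : nat) : (0 < m)%N ->
  log2 (2 * m%:R) = 1 + ln m%:R / ln 2 :> R.
Proof.
by move=> m0; rewrite /log2 lnM ?posrE ?ltr0n // mulrDl divff ?gt_eqF ?ln2_gt0.
Qed.

Lemma lnlog2_le (R : realType) (m : nat) : (0 < m)%N -> 1 <= ln m%:R :> R ->
  ln (log2 (2 * m%:R)) + ln 2 <= error_const R * Num.sqrt (ln m%:R).
Proof.
move=> m0; rewrite log2_double //; set L := ln _ => L1.
have l2 := ln2_gt0 R.
have iv : 0 < (ln 2)^-1 :> R by rewrite invr_gt0.
have s1 : 1 <= Num.sqrt L by rewrite -sqrtr1 ler_wsqrtr.
rewrite /error_const mulrDl lerD //; last by rewrite ler_peMr // ltW.
apply: le_trans (ln_le_sqrt _) _; first by nra.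
rewrite -mulrA ler_wpM2l // -sqrtrM; last lra.
by rewrite ler_wsqrtr //; nra.
Qed.

(** With s = sqrt (ln m), replacing the subtracted logarithms by C s leaves
(1 - C / s) ln m / ((m + 1) ln 2).  Passing from m + 1 to m in the denominator costs
at most the relative error 1 / (m + 1), because 1 - C / s <= 1. *)
Lemma main_term_ge (R : realType) (m : nat) : (0 < m)%N -> 1 <= ln m%:R :> R ->
  (1 - rel_error R m) * (ln m%:R / (m%:R * ln 2)) <=
    (ln m%:R - ln (log2 (2 * m%:R)) - ln 2) / ((m%:R + 1) * ln 2).
Proof.
move=> m0 L1; have A := lnlog2_le m0 L1; move: A.
rewrite /rel_error -(natr1 m); set L := ln m%:R in L1 *; set s := Num.sqrt L.
set C := error_const R => A.
have l2 := ln2_gt0 R.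
have n0 : 0 < m%:R :> R by rewrite ltr0n.
have C0 : 0 <= C by rewrite /C /error_const addr_ge0 ?mulr_ge0 ?sqrtr_ge0 // ltW.
have s1 : 1 <= s by rewrite -sqrtr1 ler_wsqrtr.
have sL : L = s ^+ 2 by rewrite sqr_sqrtr //; lra.
have n1 : 0 < m%:R + 1 :> R by lra.
apply: (@le_trans _ _ ((L - C * s) / ((m%:R + 1) * ln 2))); last first.
  by rewrite ler_pM2r ?invr_gt0 ?mulr_gt0 //; lra.
rewrite -subr_ge0.
have -> : (L - C * s) / ((m%:R + 1) * ln 2)
    - (1 - (C / s + (m%:R + 1)^-1)) * (L / (m%:R * ln 2))
   = C * s / ((m%:R + 1) * ln 2 * m%:R).
  rewrite sL; field; rewrite ?gt_eqF //; lra.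
by rewrite divr_ge0 ?mulr_ge0 //; lra.
Qed.

Lemma ln_nat_cvgy (R : realType) : (ln n%:R : R) @[n --> \oo] --> +oo.
Proof.
apply/cvgryPge => A; near=> n.
rewrite -[A]expRK ler_ln ?posrE ?expR_gt0 //; last first.
  by apply: lt_le_trans (expR_gt0 A) _; near: n; exact: nbhs_infty_ger.
by near: n; exact: nbhs_infty_ger.
Unshelve. all: by end_near. Qed.

Lemma rel_error_cvg0 (R : realType) : rel_error R m @[m --> \oo] --> (0 : R).
Proof.
rewrite -[0](addr0 0); apply: cvgD; last exact: cvg_harmonic.
rewrite -[0](mulr0 (error_const R)); apply: cvgZr.
apply/gtr0_cvgV0.
  near=> n; rewrite sqrtr_gt0; near: n; exact: (cvgry_gt (@ln_nat_cvgy R)).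
apply/cvgryPge => A; near=> n.
apply: le_trans (ler_norm A) _; rewrite -sqrtr_sqr ler_wsqrtr //.
by near: n; exact: (cvgry_ge (@ln_nat_cvgy R)).
Unshelve. all: by end_near. Qed.

Lemma lcm_upto_cvgy : lcm_upto k @[k --> \oo] --> \oo.
Proof.
apply/cvgnyPge => A; near=> k; apply: leq_trans (leq_lcm_upto k).
by near: k; exact: nbhs_infty_ge.
Unshelve. all: by end_near. Qed.

Lemma quality_lcm_upto_near (R : realType) : \forall k \near \oo,
  (1 - rel_error R (lcm_upto k)) *
      (ln (lcm_upto k)%:R / ((lcm_upto k)%:R * ln 2))
    <= quality R (Vtriple (lcm_upto k)) - 1.
Proof.
have lny := cvg_comp _ _ lcm_upto_cvgy (@ln_nat_cvgy R).
near=> k.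
have k3 : (3 <= k)%N by near: k; exact: nbhs_infty_ge.
apply: le_trans (main_term_ge (lcm_upto_gt0 k) _) _.
  by near: k; exact: (cvgry_ge lny).
by rewrite lerBrDl; exact: quality_lcm_upto_ge.
Unshelve. all: by end_near. Qed.

(** * The quality of the triples with exponent lcm(1, ..., k) *)

Theorem theorem6p32 (R : realType) :
  (forall k : nat, (3 <= k)%N ->
     1 < quality R (Vtriple (lcm_upto k))) /\
  (forall k : nat, (3 <= k)%N ->
     Delta R (lcm_upto k) >=
       ln (lcm_upto k)%:R - ln (log2 (2 * (lcm_upto k)%:R))) /\
  (forall k : nat, (4 <= k)%N ->
     quality R (Vtriple (lcm_upto k)) >=
       1 + (ln (lcm_upto k)%:R - ln (log2 (2 * (lcm_upto k)%:R)) - ln 2)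
           / (((lcm_upto k)%:R + 1) * ln 2)) /\
  (exists eps : nat -> R,
     (eps k @[k --> \oo] --> (0 : R)) /\
     (\forall k \near \oo,
        quality R (Vtriple (lcm_upto k)) - 1 >=
          (1 - eps k) * (ln (lcm_upto k)%:R / ((lcm_upto k)%:R * ln 2)))) /\
  (exists eps : nat -> R,
     (eps m @[m --> \oo] --> (0 : R)) /\
     (\forall k \near \oo,
        quality R (Vtriple (lcm_upto k)) - 1 >=
          (1 - eps (lcm_upto k)) *
            (ln (lcm_upto k)%:R / ((lcm_upto k)%:R * ln 2)))) /\
  (forall k l : nat, (k <= l)%N -> (lcm_upto k <= lcm_upto l)%N) /\
  (lcm_upto k @[k --> \oo] --> \oo).
Proof.
split; first exact: quality_lcm_upto_gt1.
split; first by move=> k k3; rewrite Delta_lcm_upto_ge // (leq_trans _ k3).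
split; first by move=> k k4; apply: quality_lcm_upto_ge; apply: leq_trans k4.
split.
  exists (rel_error R \o lcm_upto); split; last exact: quality_lcm_upto_near.
  exact: cvg_comp lcm_upto_cvgy (@rel_error_cvg0 R).
split.
  by exists (rel_error R); split;
    [exact: rel_error_cvg0 | exact: quality_lcm_upto_near].
split; [exact: lcm_upto_leq|exact: lcm_upto_cvgy].
Qed.
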